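(* Let $K$ be a field, $\mathcal{P}=\{1\}\subset\mathbb{R}$ and $w(a)=a^2$. Then the ring $A_q^w(\mathcal{P})=K[q^{a^2}x^a\mid a\in\mathbb{N}]$ is not Noetherian. In particular, $A_q^w(\mathcal{P})$ is not finitely generated as a $K$-algebra.
   Context: $\mathbb{N}=\{0,1,2,\ldots\}$. $K[q^{a^2}x^a\mid a\in\mathbb{N}]$ denotes the $K$-subalgebra of the polynomial ring $K[q,x]$ generated by the monomials $q^{a^2}x^a$, $a\in\mathbb{N}$. *)

(* Defs.v *)
From HB Require Import structures.
From mathcomp Require Import all_boot all_order all_algebra.
From mathcomp Require Import boolp classical_sets.
From mathcomp Require Import mpoly.

Set Implicit Arguments.
Unset Strict Implicit.
Unset Printing Implicit Defensive.

Import GRing.Theory.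

Local Open Scope ring_scope.
Local Open Scope classical_set_scope.

Definition is_ideal (R : comNzRingType) (I : set R) : Prop :=
  [/\ I 0, forall x y, I x -> I y -> I (x + y)
    & forall a x, I x -> I (a * x)].

Definition ideal_gen (R : comNzRingType) (S : set R) : set R :=
  \bigcap_(I in [set I | is_ideal I /\ S `<=` I]) I.

Definition noetherian (R : comNzRingType) : Prop :=
  forall I : set R, is_ideal I -> exists s : seq R, I = ideal_gen [set` s].

(* MathComp's [subalg_closed] speaks of boolean predicates, and the [by <:]
   subtype constructors need one, hence the reflection of the impredicative
   intersection into [bool]. *)
Definition subalg_gen (K : comNzRingType) (B : comAlgType K) (S : set B) :
    {pred B} :=
  fun x => `[< forall P : {pred B},
                 GRing.subalg_closed P -> S `<=` [set` P] -> x \in P >].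

Lemma subalg_gen_closed (K : comNzRingType) (B : comAlgType K) (S : set B) :
  GRing.subalg_closed (subalg_gen S).
Proof.
split.
- by apply/asboolP=> P [].
- move=> a u v /asboolP Su /asboolP Sv; apply/asboolP=> P cP SP.
  by case: (cP) => _ + _; apply; [apply: Su|apply: Sv].
- move=> u v /asboolP Su /asboolP Sv; apply/asboolP=> P cP SP.
  by case: (cP) => _ _; apply; [apply: Su|apply: Sv].
Qed.

HB.instance Definition _ (K : comNzRingType) (B : comAlgType K) (S : set B) :=
  GRing.isSubalgClosed.Build K B (subalg_gen S) (subalg_gen_closed S).

Definition fingen_algebra (K : comNzRingType) (B : comAlgType K) : Prop :=
  exists s : seq B, forall x : B, x \in subalg_gen [set` s].

Section WeightedAlgebra.
Variables (K : fieldType) (w : nat -> nat).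

(* K[q, x], with q = 'X_0 and x = 'X_1. *)
Definition wmonomial (a : nat) : {mpoly K[2]} :=
  'X_(0 : 'I_2) ^+ w a * 'X_(1 : 'I_2) ^+ a.

(* A_q^w({1}), the K-algebra K[q^(w a) x^a | a in nat]. *)
Record Aqw : Type := MkAqw {
  Aqw_val : {mpoly K[2]};
  Aqw_valP : Aqw_val \in subalg_gen (range wmonomial) }.

HB.instance Definition _ := [isSub for Aqw_val].
HB.instance Definition _ := [Choice of Aqw by <:].
HB.instance Definition _ := [SubChoice_isSubComNzRing of Aqw by <:].
HB.instance Definition _ := [SubZmodule_isSubLmodule of Aqw by <:].
HB.instance Definition _ := [SubNzRing_SubLmodule_isSubLalgebra of Aqw by <:].
HB.instance Definition _ := [SubLalgebra_isSubAlgebra of Aqw by <:].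

End WeightedAlgebra.

(* Main.v *)
Require Import Defs.
From mathcomp Require Import all_boot all_algebra.
From mathcomp Require Import boolp classical_sets.
From mathcomp Require Import mpoly zify.

(** Write [w] for the weight [a |-> a ^ 2]. It is strictly superadditive:
[w a + w b < w (a + b)] for [a, b > 0]. Hence every exponent pair [(m, a)]
occurring in an element of the algebra lies under the graph of [w], that is
[m <= w a], and a point [(w a, a)] with [a > 0] of that graph is not the sum of
two nonzero exponent pairs lying under it. Let [c_a f] be the coefficient of
[q ^ w a * x ^ a] in [f]. Then [c_0] is a ring morphism to [K], and for [a > 0]
every [c_a] is a derivation at [c_0] ([graph_coefM]):
[c_a (f * g) = c_a f * c_0 g + c_0 f * c_a g].

Given finitely many elements, each has finitely many nonzero coefficients, so
some [c_N] with [N > 0] vanishes on all of them ([graph_coef_eventually0]).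
By the Leibniz rule, [{f | c_0 f = c_N f = 0}] is an ideal and [{f | c_N f = 0}]
is a subalgebra. Neither contains the generator [q ^ w N * x ^ N], on which
[c_N] is [1]. The former shows that the augmentation ideal [{f | c_0 f = 0}]
is not finitely generated, the latter that the algebra is not. *)

Set Implicit Arguments.
Unset Strict Implicit.
Unset Printing Implicit Defensive.

Import GRing.Theory.

Local Open Scope ring_scope.
Local Open Scope classical_set_scope.

Lemma subalg_gen_gen (K : comNzRingType) (B : comAlgType K) (S : set B) :
  S `<=` [set` subalg_gen S].
Proof. by move=> x Sx; apply/asboolP => P _; apply. Qed.

Lemma subalg_gen_ind (K : comNzRingType) (B : comAlgType K) (S : set B)
    (P : {pred B}) (x : B) :
  GRing.subalg_closed P -> S `<=` [set` P] -> x \in subalg_gen S -> x \in P.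
Proof. by move=> cP SP /asboolP; apply. Qed.

Lemma ideal_gen_sub (R : comNzRingType) (S I : set R) :
  is_ideal I -> S `<=` I -> ideal_gen S `<=` I.
Proof. by move=> idI SI x; apply. Qed.

Lemma ideal_gen_gen (R : comNzRingType) (S : set R) : S `<=` ideal_gen S.
Proof. by move=> x Sx I [_]; apply. Qed.

(* The indices of the variables [q] and [x]. *)
Local Notation iq := (0%R : 'I_2).
Local Notation ix := (1%R : 'I_2).

Section StrictlySuperadditiveWeight.
Variables (K : fieldType) (w : nat -> nat).
Hypothesis w0 : w 0 = 0%N.
Hypothesis wD : forall a b, (0 < a)%N -> (0 < b)%N -> (w a + w b < w (a + b))%N.

(** The exponent of [q ^ w a * x ^ a]: the point of the graph of [w] over [a]. *)
Definition graph_mnm (a : nat) : 'X_{1..2} :=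
  (U_(iq) *+ w a + U_(ix) *+ a)%MM.

Lemma wmonomialE a : wmonomial K w a = 'X_[graph_mnm a].
Proof. by rewrite /wmonomial /graph_mnm mpolyXD -!mpolyXn. Qed.

Lemma graph_mnm_q a : graph_mnm a iq = w a.
Proof. by rewrite mnmDE !mulmnE !mnm1E /= mul1n mul0n addn0. Qed.

Lemma graph_mnm_x a : graph_mnm a ix = a.
Proof. by rewrite mnmDE !mulmnE !mnm1E /= mul1n mul0n. Qed.

Lemma eq_graph_mnm (m : 'X_{1..2}) a : m iq = w a -> m ix = a -> m = graph_mnm a.
Proof.
move=> m0 m1; apply/mnmP; case=> [] [|[|//]] lti.
  by rewrite (_ : Ordinal lti = iq) ?m0 ?graph_mnm_q //; apply/val_inj.
by rewrite (_ : Ordinal lti = ix) ?m1 ?graph_mnm_x //; apply/val_inj.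
Qed.

Lemma graph_mnm0 : graph_mnm 0 = 0%MM.
Proof. by apply/esym/eq_graph_mnm; rewrite mnmE ?w0. Qed.

Lemma graph_mnm_inj : injective graph_mnm.
Proof. by move=> a b eq_ab; rewrite -(graph_mnm_x a) eq_ab graph_mnm_x. Qed.

Lemma weight_superadd a b : (w a + w b <= w (a + b))%N.
Proof.
have [->|a_gt0] := posnP a; first by rewrite w0.
have [->|b_gt0] := posnP b; first by rewrite w0 !addn0.
exact/ltnW/wD.
Qed.

Definition under_graph (m : 'X_{1..2}) : bool := (m iq <= w (m ix))%N.

Lemma under_graphD m n :
  under_graph m -> under_graph n -> under_graph (m + n)%MM.
Proof.
rewrite /under_graph !mnmDE => le_m le_n.
exact: leq_trans (leq_add le_m le_n) (weight_superadd _ _).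
Qed.

Definition supp_under_graph : {pred {mpoly K[2]}} :=
  fun p => all under_graph (msupp p).

(** The points under the graph of a superadditive function vanishing at [0] form
an additive monoid, so the polynomials supported there form a subalgebra. *)
Lemma supp_under_graph_closed : GRing.subalg_closed supp_under_graph.
Proof.
split=> [|c p q /allP Sp /allP Sq|p q /allP Sp /allP Sq].
- by apply/allP=> m; rewrite msupp1 inE => /eqP ->; rewrite /under_graph mnmE.
- apply/allP=> m /msuppD_le; rewrite mem_cat.
  by case/orP=> [/msuppZ_le|]; [exact: Sp|exact: Sq].
- apply/allP=> m /msuppM_le /allpairsP[[m1 m2] /= [/Sp Sm1 /Sq Sm2 ->]].
  exact: under_graphD.
Qed.

Lemma Aqw_under_graph (f : Aqw K w) m : m \in msupp (\val f) -> under_graph m.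
Proof.
suff: \val f \in supp_under_graph by move/allP; apply.
apply: subalg_gen_ind (Aqw_valP f); first exact: supp_under_graph_closed.
move=> _ [a _ <-]; apply/allP => m0; rewrite wmonomialE msuppX inE => /eqP ->.
by rewrite /under_graph graph_mnm_q graph_mnm_x.
Qed.

(** If the [x]-exponents [b] and [c] of the two summands were both positive, their
[q]-exponents would add up to at most [w b + w c < w (b + c) = w a]. A summand
with [x]-exponent [0] also has [q]-exponent [0], because [w 0 = 0]. *)
Lemma graph_mnm_split a m n : under_graph m -> under_graph n ->
  (m + n)%MM = graph_mnm a -> m = 0%MM \/ n = 0%MM.
Proof.
rewrite /under_graph => le_m le_n mnE.
have := graph_mnm_q a; have := graph_mnm_x a.
rewrite -mnE !mnmDE => aE waE.
have [m1|m1_gt0] := posnP (m ix).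
  left; rewrite -graph_mnm0; apply: eq_graph_mnm => //.
  by move: le_m; rewrite m1 w0 leqn0 => /eqP.
have [n1|n1_gt0] := posnP (n ix).
  right; rewrite -graph_mnm0; apply: eq_graph_mnm => //.
  by move: le_n; rewrite n1 w0 leqn0 => /eqP.
by have := wD m1_gt0 n1_gt0; rewrite aE; lia.
Qed.

Definition graph_coef (a : nat) (f : Aqw K w) : K := (\val f)@_(graph_mnm a).

Lemma graph_coef_linear a c f g :
  graph_coef a (c *: f + g) = c * graph_coef a f + graph_coef a g.
Proof. by rewrite /graph_coef (linearP (\val : Aqw K w -> _)) mcoeffD mcoeffZ. Qed.

Lemma graph_coefD a f g : graph_coef a (f + g) = graph_coef a f + graph_coef a g.
Proof. by rewrite -[f in LHS]scale1r graph_coef_linear mul1r. Qed.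

Lemma graph_coef0M f g :
  graph_coef 0 (f * g) = graph_coef 0 f * graph_coef 0 g.
Proof. by rewrite /graph_coef rmorphM graph_mnm0 rmorphM. Qed.

(** In the convolution product, only the two trivial decompositions of
[graph_mnm a] contribute, by [graph_mnm_split]. *)
Lemma graph_coefM a f g : (0 < a)%N ->
  graph_coef a (f * g) =
    graph_coef a f * graph_coef 0 g + graph_coef 0 f * graph_coef a g.
Proof.
move=> a_gt0; rewrite /graph_coef rmorphM graph_mnm0.
set m := graph_mnm a.
have m_neq0 : m != 0%MM.
  by apply/eqP; rewrite -graph_mnm0 => /graph_mnm_inj a0; rewrite a0 in a_gt0.
(* [mcoeffM] sums over pairs of exponents of bounded degree: the two surviving
   terms are repackaged accordingly. *)
pose bm := BMultinom (ltnSn (mdeg m)).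
have lt0 : (mdeg (0%MM : 'X_{1..2}) < (mdeg m).+1)%N by rewrite mdeg0.
pose b0 := BMultinom lt0.
rewrite mcoeffM (bigD1 (bm, b0)) /= ?addm0 //.
rewrite (bigD1 (b0, bm)) /= ?add0m ?eqxx /=; last first.
  by rewrite xpair_eqE -!val_eqE /= negb_and eq_sym m_neq0.
rewrite big1 ?addr0 // => -[k l] /= /andP[/andP[/eqP mE kl_neq1] kl_neq2].
have [/Aqw_under_graph uk|/memN_msupp_eq0 ->] := boolP (bmnm k \in msupp (\val f));
  last by rewrite mul0r.
have [/Aqw_under_graph ul|/memN_msupp_eq0 ->] := boolP (bmnm l \in msupp (\val g));
  last by rewrite mulr0.
have [k0|l0] := graph_mnm_split uk ul (esym mE).
  case/eqP: kl_neq2; congr pair; apply/val_inj => //=.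
  by move/esym: mE; rewrite k0 add0m.
case/eqP: kl_neq1; congr pair; apply/val_inj => //=.
by move/esym: mE; rewrite l0 addm0.
Qed.

Definition Aqw_gen (a : nat) : Aqw K w :=
  MkAqw (@subalg_gen_gen _ _ (range (wmonomial K w)) _ (imageT _ a)).

Lemma graph_coef_gen a b : graph_coef a (Aqw_gen b) = (b == a)%:R.
Proof.
by rewrite /graph_coef /= wmonomialE mcoeffX (inj_eq graph_mnm_inj).
Qed.

Lemma graph_coef1 a : graph_coef a 1 = (a == 0%N)%:R.
Proof.
by rewrite /graph_coef rmorph1 mcoeff1 -graph_mnm0 (inj_eq graph_mnm_inj).
Qed.

Lemma graph_coef_zero a : graph_coef a 0 = 0.
Proof. by rewrite /graph_coef !raddf0. Qed.

Lemma graph_coef_eventually0 (s : seq (Aqw K w)) :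
  exists2 N, (0 < N)%N & forall f, f \in s -> graph_coef N f = 0.
Proof.
(* Beyond the degrees of all the [f], since [graph_mnm N] has degree at least [N]. *)
exists (\max_(f <- s) msize (\val f)).+1 => // f fs.
apply/memN_msupp_eq0/negP => /msize_mdeg_lt; apply/negP; rewrite -leqNgt.
have /leq_trans := @leq_bigmax_seq _ s predT (fun g => msize (\val g)) f fs isT.
apply.
by rewrite mdegD !mdegMn !mdeg1 !mul1n (leq_trans (leqnSn _)) ?leq_addl.
Qed.

(** The ideal without a finite generating set is the augmentation ideal [I]: any
finite part of it lies in a proper subideal [J] cut out by one more coefficient. *)
Lemma Aqw_not_noetherian : ~ noetherian (Aqw K w).
Proof.
pose I : set (Aqw K w) := [set f | graph_coef 0 f = 0].
have idI : is_ideal I.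
  split=> [|f g /= f0 g0|f g /= g0]; first exact: graph_coef_zero.
    by rewrite /I /= graph_coefD f0 g0 addr0.
  by rewrite /I /= graph_coef0M g0 mulr0.
case/(_ I idI) => s Is.
have [N N_gt0 sN] := graph_coef_eventually0 s.
pose J : set (Aqw K w) := [set f | graph_coef 0 f = 0 /\ graph_coef N f = 0].
have idJ : is_ideal J.
  split=> [|f g [f0 fN] [g0 gN]|f g [g0 gN]].
  - by split; exact: graph_coef_zero.
  - by split; rewrite graph_coefD ?f0 ?g0 ?fN ?gN addr0.
  - by split; rewrite ?graph_coef0M ?graph_coefM // g0 ?gN !mulr0 ?addr0.
have IJ : I `<=` J.
  rewrite {1}Is; apply: (ideal_gen_sub idJ) => f fs; split; last exact: sN.
  by have : I f by rewrite Is; apply: ideal_gen_gen.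
have /IJ [_] : I (Aqw_gen N).
  by rewrite /I /= graph_coef_gen eqn0Ngt N_gt0.
by rewrite graph_coef_gen eqxx => /eqP; rewrite oner_eq0.
Qed.

Lemma Aqw_not_fingen : ~ fingen_algebra (Aqw K w).
Proof.
case=> s gen_s.
have [N N_gt0 sN] := graph_coef_eventually0 s.
pose P : {pred Aqw K w} := fun f => graph_coef N f == 0.
suff : Aqw_gen N \in P.
  by rewrite unfold_in graph_coef_gen eqxx oner_eq0.
apply: (subalg_gen_ind (P := P) _ _ (gen_s _)); last first.
  by move=> f fs /=; apply/eqP/sN.
split=> [|c f g /eqP fN /eqP gN|f g /eqP fN /eqP gN]; rewrite unfold_in.
- by rewrite graph_coef1 eqn0Ngt N_gt0.
- by rewrite graph_coef_linear fN gN mulr0 addr0.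
- by rewrite graph_coefM // fN gN mul0r mulr0 addr0.
Qed.

End StrictlySuperadditiveWeight.

Theorem proposition2p2 (K : fieldType) :
  ~ noetherian (Aqw K (fun a : nat => (a ^ 2)%N)) /\
  ~ fingen_algebra (Aqw K (fun a : nat => (a ^ 2)%N)).
Proof.
have sqrD a b : (0 < a)%N -> (0 < b)%N -> (a ^ 2 + b ^ 2 < (a + b) ^ 2)%N.
  by nia.
by split; [apply: Aqw_not_noetherian|apply: Aqw_not_fingen].
Qed.
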